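(* Let $n\geq 3$ be odd and let $t$ be a divisor of $n$. Let $G=D_{2n}=\langle a,b : a^n=b^2=e,\ b^{-1}ab=a^{-1}\rangle$ and let $H=\langle a^t\rangle$. Let $(\alpha,\beta)\neq(0,0)$ be a pair of non-negative integers. Then $H$ is an $(\alpha,\beta)$-regular set of $G$ if and only if $t=1$ and $(\alpha,\beta)=(0,|H|)$.
   Context: $D_{2n}$ is the dihedral group of order $2n$; divisors are positive. An element $x$ of a group $G$ is a square if $x=y^2$ for some $y\in G$. A subset of $G$ is square-free if none of its elements is a square of $G$; a subset $S$ is normal if $g^{-1}Sg=S$ for all $g\in G$. For a normal square-free subset $S$ of $G$ (possibly empty), the Cayley sum graph $\mathrm{CayS}(G,S)$ is the simple graph with vertex set $G$ in which $x,y$ are adjacent if and only if $xy\in S$. A set $C$ of vertices of a graph is an $(\alpha,\beta)$-regular set in the graph if every vertex in $C$ is adjacent to exactly $\alpha$ vertices of $C$ and every vertex not in $C$ is adjacent to exactly $\beta$ vertices of $C$. A subset $C\subseteq G$ is an $(\alpha,\beta)$-regular set of $G$ if it is an $(\alpha,\beta)$-regular set in $\mathrm{CayS}(G,S)$ for some normal square-free subset $S$ of $G$. *)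

(* Defs.v *)
From HB Require Import structures.
From mathcomp Require Import all_boot all_fingroup all_solvable.

Set Implicit Arguments.
Unset Strict Implicit.
Unset Printing Implicit Defensive.

Local Open Scope group_scope.

Definition is_square (gT : finGroupType) (x : gT) : Prop :=
  exists y : gT, x = y ^+ 2.

Definition square_free (gT : finGroupType) (S : {set gT}) : Prop :=
  forall x : gT, x \in S -> ~ is_square x.

(* [S :^ g] is the conjugate set g^-1 S g; [S <| _] is avoided because S need
   not be a subgroup. *)
Definition normal_subset (gT : finGroupType) (S : {set gT}) : Prop :=
  forall g : gT, S :^ g = S.

Definition CayS (gT : finGroupType) (S : {set gT}) : rel gT :=
  [rel x y | x * y \in S].

(* Normality and square-freeness of S are what make CayS a simple graph. *)
Lemma CayS_sym (gT : finGroupType) (S : {set gT}) :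
  normal_subset S -> symmetric (CayS S).
Proof.
by move=> nS x y; rewrite /= -[RHS](memJ_conjg _ x^-1) nS conjgE invgK !mulgA mulgK.
Qed.

Lemma CayS_irr (gT : finGroupType) (S : {set gT}) :
  square_free S -> irreflexive (CayS S).
Proof. by move=> sfS x; apply/negP => /sfS; case; exists x. Qed.

Definition regular_set_in (T : finType) (e : rel T) (C : {set T})
    (alpha beta : nat) : Prop :=
  forall x : T,
    #|[set y in C | e x y]| = if x \in C then alpha else beta.

Definition regular_set (gT : finGroupType) (C : {set gT})
    (alpha beta : nat) : Prop :=
  exists S : {set gT},
    [/\ normal_subset S, square_free S & regular_set_in (CayS S) C alpha beta].

(* Main.v *)
(** Since [n] is odd, the squares of [D_{2n}] are exactly the rotations [<a>],
    and the reflections form a single conjugacy class.  So a nonempty normal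
    square-free set can only be the set [S] of all reflections, and in
    [CayS(G, S)] two vertices are adjacent iff exactly one of them is a rotation.
    As [H] consists of rotations, every rotation has no neighbour in [H] and every
    reflection has [|H|] of them; a rotation outside [H] (present iff [t <> 1])
    would thus force [(alpha, beta) = (0, 0)]. *)
Require Import Defs.
From HB Require Import structures.
From mathcomp Require Import all_boot all_fingroup all_solvable.

Set Implicit Arguments.
Unset Strict Implicit.
Unset Printing Implicit Defensive.

Local Open Scope group_scope.

Definition dihedral_gens (gT : finGroupType) (n : nat) (a b : gT) : Prop :=
  [/\ <<[set a; b]>> = [set: gT], #[a] = n, #|gT| = n.*2 & a ^ b = a^-1].

(** The relation [a ^+ n = 1] only bounds [#[a]] from above. Since [b] normalises [<[a]>], the whole
    group is [<[a]> * <[b]>], so [n.*2 <= #[a] * #[b] <= #[a] * 2] gives the other bound. *)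
Lemma dihedral_gens_order (gT : finGroupType) (n : nat) (a b : gT) :
  0 < n -> #|gT| = n.*2 -> <<[set a; b]>> = [set: gT] ->
  a ^+ n = 1 -> b ^+ 2 = 1 -> b^-1 * a * b = a^-1 -> dihedral_gens n a b.
Proof.
move=> n_gt0 oG genG an1 b21; rewrite -mulgA -conjgE => ab; split=> //.
apply/eqP; rewrite eqn_leq; apply/andP; split.
  by rewrite dvdn_leq // order_dvdn an1.
have nAB: <[b]> \subset 'N(<[a]>) by rewrite norms_cycle ab groupV cycle_id.
have ob: #[b] <= 2 by rewrite dvdn_leq // order_dvdn b21.
have defG: <[a]> * <[b]> = [set: gT].
  by rewrite -norm_joinEr // -genG joing_idl joing_idr.
have: #|gT| <= #[a] * #[b].
  by rewrite -cardsT -defG mul_cardG leq_pmulr // cardG_gt0.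
rewrite oG -muln2 => le_n2; rewrite -(leq_pmul2r (isT : 0 < 2)).
by apply: leq_trans le_n2 _; rewrite leq_mul2l ob orbT.
Qed.

Section Dihedral.

Variables (gT : finGroupType) (n : nat) (a b : gT).
Hypotheses (odd_n : odd n) (gens_ab : dihedral_gens n a b).

Lemma index_rotations : #|[set: gT] : <[a]>| = 2.
Proof.
case: gens_ab => _ oa oG _; apply/eqP.
have n_gt0: 0 < n by apply: odd_gt0.
by rewrite -divgS ?subsetT // cardsT oG -/(order a) oa -muln2 mulKn.
Qed.

Lemma reflection_gen_notin : b \notin <[a]>.
Proof.
case: gens_ab => genG _ _ _; apply/negP=> Ab.
have: #|[set: gT] : <[a]>| > 1 by rewrite index_rotations.
suff sGA: [set: gT] \subset <[a]> by rewrite indexg_gt1 sGA.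
by rewrite -genG gen_subG subUset !sub1set cycle_id.
Qed.

Lemma reflections_rcoset (x : gT) : x \notin <[a]> -> <[a]> :* x = ~: <[a]>.
Proof.
move=> Ax; rewrite (rcoset_index2 (subsetT _) index_rotations) ?setTD //.
by rewrite !inE Ax.
Qed.

(** Parity in the quotient by the index-two subgroup [<[a]>]. *)
Lemma mem_rotationsM (x y : gT) :
  (x * y \in <[a]>) = ((x \in <[a]>) == (y \in <[a]>)).
Proof.
have [Ax | nAx] := boolP (x \in <[a]>).
  by rewrite groupMl //; case: (_ \in _).
have [Ay | nAy] := boolP (y \in <[a]>).
  by rewrite groupMr // (negbTE nAx).
apply/negPn/negP => nAxy.
have: x * y \in <[a]> :* y by rewrite reflections_rcoset // inE.
by rewrite mem_rcoset mulgK (negbTE nAx).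
Qed.

(** Write [s] as [a ^+ i * b]: the first factor commutes with [a], and [b] inverts it. *)
Lemma conj_rotation_reflection (s : gT) : s \notin <[a]> -> a ^ s = a^-1.
Proof.
case: gens_ab => _ _ _ ab nAs.
have: s \in <[a]> :* b.
  by rewrite reflections_rcoset ?reflection_gen_notin // inE.
case/rcosetP=> _ /cycleP[i ->] ->.
have aai: a ^ (a ^+ i) = a by apply/conjg_fixP/commgP/commuteX.
by rewrite conjgM aai.
Qed.

(** Squaring is a bijection of [<[a]>], whose order is odd; the root is the power of [x] by an
    inverse of 2 modulo that order. *)
Lemma rotation_sqrt (x : gT) :
  x \in <[a]> -> exists2 y, y \in <[a]> & x = y ^+ 2.
Proof.
case: gens_ab => _ oa _ _ Ax.
have co2: coprime #|<[a]>| 2 by rewrite -/(order a) oa coprimen2.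
exists (x ^+ expg_invn <[a]> 2); first exact: groupX.
by rewrite -expgM mulnC expgM expgK.
Qed.

Lemma square_rotation (x : gT) : is_square x <-> x \in <[a]>.
Proof.
split=> [[y ->] | /rotation_sqrt[y _ ->]]; last by exists y.
by rewrite expgS expg1 mem_rotationsM.
Qed.

Lemma normal_square_free_sub (S : {set gT}) :
  normal_subset S -> square_free S -> S != set0 -> S = ~: <[a]>.
Proof.
move=> nS sfS /set0Pn[s Ss].
have nAS x : x \in S -> x \notin <[a]>.
  by move=> /sfS sqx; apply/negP => /square_rotation.
apply/eqP; rewrite eqEsubset; apply/andP; split.
  by apply/subsetP => x /nAS; rewrite inE.
(* The coset of [s] is all of [~: <[a]>], and each of its elements is [y ^+ 2 * s] for some rotation
   [y], because rotations have rotation square roots. *)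
rewrite -(reflections_rcoset (nAS s Ss)).
apply/subsetP => _ /rcosetP[_ /rotation_sqrt[_ /cycleP[i ->] ->] ->].
(* As [s] inverts [y = a ^+ i], conjugating [s] by [y^-1] gives [y ^+ 2 * s] *)
have ys: (a ^+ i) ^ s = (a ^+ i)^-1.
  by rewrite conjXg conj_rotation_reflection ?nAS // expgVn.
suff <-: s ^ (a ^+ i)^-1 = (a ^+ i) ^+ 2 * s.
  by rewrite -(nS (a ^+ i)^-1) memJ_conjg.
by rewrite conjgE invgK -ys conjgE mulKVg mulgA.
Qed.

Lemma normal_reflections : normal_subset (~: <[a]>).
Proof.
move=> g; apply/setP=> x; rewrite mem_conjg !inE conjgE !mem_rotationsM !groupV.
by do 2!case: (_ \in _).
Qed.

Lemma square_free_reflections : square_free (~: <[a]>).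
Proof. by move=> x; rewrite inE => /negP nAx /square_rotation. Qed.

Lemma card_reflection_neighbours (H : {set gT}) (x : gT) :
  H \subset <[a]> ->
  #|[set y in H | CayS (~: <[a]>) x y]| = if x \in <[a]> then 0 else #|H|.
Proof.
move=> /subsetP sHA.
have -> : [set y in H | CayS (~: <[a]>) x y]
        = if x \in <[a]> then set0 else H.
  apply/setP=> y; rewrite inE /CayS /= in_setC mem_rotationsM.
  by case: ifP => _; rewrite ?inE; case: (boolP (y \in H)) => //= /sHA->.
by case: ifP => _; rewrite ?cards0.
Qed.

End Dihedral.

Theorem theorem3p7 (n t : nat) (a b : 'D_(n.*2)) (alpha beta : nat) :
  3 <= n -> odd n -> t %| n ->
  <<[set a; b]>> = [set: 'D_(n.*2)] ->
  a ^+ n = 1 -> b ^+ 2 = 1 -> b^-1 * a * b = a^-1 ->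
  (alpha, beta) <> (0%N, 0%N) ->
  regular_set <[a ^+ t]> alpha beta <->
  t = 1%N /\ (alpha, beta) = (0%N, #|<[a ^+ t]>|).
Proof.
move=> n_ge3 odd_n t_dvd_n genG an1 b21 ab nz.
have oG: #|{: 'D_(n.*2)}| = n.*2 by rewrite -cardsT card_dihedral // ltnW.
have gens := dihedral_gens_order (ltnW (ltnW n_ge3)) oG genG an1 b21 ab.
have [_ oa _ _] := gens.
have sHA := cycleX a t.
split=> [[S [nS sfS regS]] | [t1 [-> ->]]]; last first.
  exists (~: <[a]>); split.
  - exact: (normal_reflections odd_n gens).
  - exact: (square_free_reflections odd_n gens).
  by move=> x; rewrite (card_reflection_neighbours odd_n gens) // t1 expg1.
have n_gt0: 0 < n by apply: odd_gt0.
have nAb := reflection_gen_notin odd_n gens.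
(* An empty [S] gives a graph without edges; the vertices [1] in H and [b] outside H then force both
   parameters to vanish. *)
have [S0 | S_neq0] := eqVneq S set0.
  have regS0 x : (if x \in <[a ^+ t]> then alpha else beta) = 0%N.
    rewrite -regS S0; apply: eq_card0 => y.
    by rewrite inE /CayS /= in_set0 andbF.
  case: nz; have := regS0 1; rewrite group1 => ->; have := regS0 b.
  by rewrite (negbTE (contra (subsetP sHA b) nAb)) => ->.
move: regS; rewrite (normal_square_free_sub odd_n gens nS sfS S_neq0) => regS.
have valE x : (if x \in <[a ^+ t]> then alpha else beta)
            = (if x \in <[a]> then 0 else #|<[a ^+ t]>|).
  by rewrite -regS (card_reflection_neighbours odd_n gens).
(* Three test vertices suffice: [1] gives [alpha = 0], [a] would give [beta = 0] if it lay outside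
   H, and [b] gives [beta = #|H|]. *)
have := valE 1; rewrite !group1 => alpha0.
have Ha: a \in <[a ^+ t]>.
  apply/negPn/negP => nHa; case: nz.
  by have := valE a; rewrite cycle_id (negbTE nHa) alpha0 => ->.
have HA: <[a ^+ t]> = <[a]>.
  by apply/eqP; rewrite eqEsubset sHA cycle_subG.
split; last first.
  by have := valE b; rewrite HA (negbTE nAb) alpha0 => ->.
(* Compare orders: [a ^+ t] has order [n %/ t] but generates [<[a]>], of order [n]. *)
have nt: n %/ t = n by rewrite -{1}oa -orderXdiv ?oa // /order HA.
by apply/eqP; rewrite -(eqn_pmul2l n_gt0) muln1 -{1}nt divnK.
Qed.
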